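(* Assume that $2\mu<\nu\alpha^{2}$ and that $0<\beta^{2}(r)<\eta$ for every $r\in[a,b]$. Let $\overline{\zeta}_{2},\overline{\zeta}_{3}\in C[a,b]$ be the solutions of $f(\zeta(r))=\beta^{2}(r)$ $(r\in[a,b])$ with $-\mu>\overline{\zeta}_{2}>\rho>\overline{\zeta}_{3}>-\tfrac{1}{2}\nu\alpha^{2}$ on $[a,b]$, and set $\overline{v}_{i}(r):=r^{-1}\left(\alpha-\beta(r)/(\overline{\zeta}_{i}(r)+\mu)\right)$ for $r\in[a,b]$, $i\in\{2,3\}$. Then $\overline{v}_{2}$ is not a local minimum point of $\widehat{\mathcal{P}}$ on $\mathcal{L}^{4}$, and $\overline{v}_{3}$ is not a local maximum point of $\widehat{\mathcal{P}}$ on $\mathcal{L}^{4}$ (local with respect to the norm of $\mathcal{L}^{4}$).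
   Context: Let $\alpha,\mu,\nu,\tau_{\theta}>0$ and $0<a<b$ be real numbers. For $r\in[a,b]$ set $\sigma(r):=b^{2}\tau_{\theta}r^{-2}$ and $\beta(r):=\alpha\mu-\sigma(r)$. Put $\rho:=-\tfrac{1}{3}(\mu+\nu\alpha^{2})$, $\eta:=(\nu\alpha^{2}-2\mu)^{3}/(27\nu)$, and $f(\varsigma):=(2\nu^{-1}\varsigma+\alpha^{2})(\mu+\varsigma)^{2}$ for $\varsigma\in\mathbb{R}$. Under the hypotheses of the claim, for each $r\in[a,b]$ the equation $f(\varsigma)=\beta^{2}(r)$ has exactly three real solutions, one in $(-\mu,\infty)$, one in $(\rho,-\mu)$ and one in $(-\tfrac12\nu\alpha^2,\rho)$, and they depend continuously on $r$. Write $\mathcal{L}^{4}:=\mathcal{L}^{4}(a,b)$ for the usual real Lebesgue space. Define $\widehat{\mathcal{P}}:\mathcal{L}^{4}\to\mathbb{R}$ by \[ \widehat{\mathcal{P}}(v):=2\pi\int_{a}^{b}\left[\tfrac{1}{2}\mu r^{2}v(r)^{2}+\tfrac{1}{2}\nu\left(\tfrac{1}{2}r^{2}v(r)^{2}-\alpha r v(r)\right)^{2}-\sigma(r)\,r\,v(r)\right]r\,dr . \] *)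

(* Defs.v *)
From HB Require Import structures.
From mathcomp Require Import all_boot all_order all_algebra.
From mathcomp Require Import all_classical all_reals all_analysis.

Set Implicit Arguments.
Unset Strict Implicit.
Unset Printing Implicit Defensive.

Import Order.TTheory GRing.Theory Num.Theory.
Import numFieldNormedType.Exports.

Local Open Scope classical_set_scope.
Local Open Scope ring_scope.

Section Lebesgue_space.
Context d (T : measurableType d) (R : realType).
Variables (m : {measure set T -> \bar R}) (p : \bar R) (p1 : (1 <= p)%E).

(* The library's quotient space carries no normed-module structure, so the
   distance is read off representatives; it depends only on the classes. *)
Definition Lspace_dist (u v : LspaceType m p1) : \bar R :=
  'N[m]_p[(fun x => ((u x : R) - (v x : R))%:E)]%E.

Definition is_local_min (F : LspaceType m p1 -> R) (v : LspaceType m p1) :=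
  exists2 e : R, 0 < e &
    forall w : LspaceType m p1, (Lspace_dist w v < e%:E)%E -> F v <= F w.

Definition is_local_max (F : LspaceType m p1 -> R) (v : LspaceType m p1) :=
  exists2 e : R, 0 < e &
    forall w : LspaceType m p1, (Lspace_dist w v < e%:E)%E -> F w <= F v.

End Lebesgue_space.

Section L4.
Context (R : realType).

(* Library L^p spaces live on the whole measurable space, so (a, b) enters
   through the measure: values outside ]a, b[ are negligible. *)
Definition lebesgue_on (a b : R) :
    {measure set (measurableTypeR R) -> \bar R} :=
  mrestr lebesgue_measure (measurable_itv `]a, b[ : measurable `]a, b[).

Lemma le1_4e : (1 <= 4%:R%:E :> \bar R)%E.
Proof. by rewrite lee_fin ler1n. Qed.

Definition L4 (a b : R) := LspaceType (lebesgue_on a b) le1_4e.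

End L4.

Section functional.
Context (R : realType).
Variables (alpha mu nu tau a b : R).

Definition sigma (r : R) : R := b ^+ 2 * tau * r ^- 2.

Definition beta (r : R) : R := alpha * mu - sigma r.

Definition rho : R := - (1 / 3) * (mu + nu * alpha ^+ 2).

(* Underscore: [eta] is already a constant of Hierarchy Builder. *)
Definition eta_ : R := (nu * alpha ^+ 2 - 2 * mu) ^+ 3 / (27 * nu).

Definition cubic (s : R) : R := (2 * nu^-1 * s + alpha ^+ 2) * (mu + s) ^+ 2.

Definition vbar (zeta : R -> R) (r : R) : R :=
  r^-1 * (alpha - beta r / (zeta r + mu)).

(* For v in L^4(a, b) the integrand is integrable, so the conversion
   to R built into the real-valued integral loses nothing. *)
Definition Phat (v : L4 a b) : R :=
  2 * pi * \int[lebesgue_measure]_(r in `]a, b[)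
    ((1 / 2 * mu * r ^+ 2 * (v r : R) ^+ 2
      + 1 / 2 * nu * (1 / 2 * r ^+ 2 * (v r : R) ^+ 2 - alpha * r * (v r : R)) ^+ 2
      - sigma r * r * (v r : R)) * r).

End functional.

(* Main.v *)
Require Import Defs.
From HB Require Import structures.
From mathcomp Require Import all_boot all_order all_algebra.
From mathcomp Require Import all_classical all_reals all_analysis.
From mathcomp Require Import measurable_realfun.
From mathcomp Require Import ring lra.

Import Order.TTheory GRing.Theory Num.Theory.
Import numFieldNormedType.Exports.

Local Open Scope classical_set_scope.
Local Open Scope ring_scope.

(** Put y = (alpha + t) / r. Up to a term depending on r alone, the integrand at
    (r, y) is r times the double well
      nu / 8 (t^2 - alpha^2)^2 + mu / 2 t^2 + beta(r) t,
    and the profile attached to zeta is t = - beta / (zeta + mu). Both zeta2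
    and zeta3 stay below - mu (for zeta3 because rho < - mu), hence beta t > 0.
    The linear term therefore decides two comparisons at every r:
    - reflecting t to - t lowers the well by 2 beta t ([well_reflect]);
    - pushing t away from the origin, to t + 2 alpha^2 / t, raises it
      ([well_stretch]).

    For zeta2 the second derivative in y is positive and for zeta3 it is
    negative, so neither comparison can be made with a small pointwise change.
    It can with a change that is small in L^4: substitute the competitor on a
    short interval ]a, c[ only. The size of the jump is bounded, so the L^4
    distance tends to 0 with c - a ([needle_close]), whereas the energy changes
    with the sign of the pointwise comparison ([lt_Rintegral_needle]). Thus the
    lower competitor excludes a local minimum ([not_local_min_of_lower]) and the
    higher one a local maximum ([not_local_max_of_higher]). *)

(** * Norms, classes and strict comparison of integrals *)

Lemma Lnorm_ae_eq d (T : measurableType d) (R : realType)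
    (m : {measure set T -> \bar R}) (p : R) (f g : T -> R) :
  measurable_fun setT f -> measurable_fun setT g -> f = g %[ae m] ->
  ('N[m]_p%:E[EFin \o f] = 'N[m]_p%:E[EFin \o g])%E.
Proof.
move=> mf mg fg.
have mpow (h : T -> R) : measurable_fun setT h ->
    measurable_fun setT (fun x : T => (`|(EFin \o h) x| `^ p)%E).
  move=> mh; apply: (@measurableT_comp _ _ _ _ _ _ (@poweR R ^~ p)).
    exact: measurable_poweR.
  by apply: measurableT_comp => //; exact/measurable_EFinP.
rewrite unlock (ae_eq_integral (fun x => (`|(EFin \o g) x| `^ p)%E))//.
- exact: mpow.
- exact: mpow.
- by apply: filterS fg => x /(_ Logic.I) + _ => /= ->.
Qed.

Lemma Lnorm_le_indic d (T : measurableType d) (R : realType)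
    (m : {measure set T -> \bar R}) (p K : R) (f : T -> R) (E : set T) :
  0 < p -> 0 <= K -> measurable E -> measurable_fun setT f ->
  (forall x, `|f x| <= K * \1_E x) ->
  ('N[m]_p%:E[EFin \o f] `^ p <= (K `^ p)%:E * m E)%E.
Proof.
move=> p0 K0 mE mf fK; rewrite poweR_Lnorm ?gt_eqF//.
rewrite -[X in m X]setIT -(integral_indic m measurableT mE).
rewrite -ge0_integralZl_EFin//; last 2 first.
- exact/measurable_EFinP.
- exact: powR_ge0.
apply: ge0_le_integral => //.
- by move=> x _; exact: poweR_ge0.
- apply: (@measurableT_comp _ _ _ _ _ _ (@poweR R ^~ p)).
    exact: measurable_poweR.
  by apply: measurableT_comp => //; exact/measurable_EFinP.
- by apply/measurable_EFinP; apply: measurable_funM.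
- move=> x _ /=; rewrite lee_fin.
  have := fK x; rewrite indicE; case: (x \in E) => /=.
    by rewrite !mulr1 => fxK; apply: ge0_ler_powR; rewrite ?nnegrE// ltW.
  by rewrite !mulr0 normr_le0 => /eqP->; rewrite normr0 powR0// gt_eqF.
Qed.

(** The elements of the Lebesgue space are classes read through a chosen
    representative, hence equality almost everywhere only. *)
Lemma Lspace_of_fun d (T : measurableType d) (R : realType)
    (m : {measure set T -> \bar R}) (p : R) (p1 : (1 <= p%:E)%E) (f : T -> R) :
  measurable_fun setT f -> finite_norm m p%:E f ->
  exists u : LspaceType m p1, (u : T -> R) = f %[ae m].
Proof.
move=> mf ff.
pose F : {mfun T >-> measurableTypeR R} :=
  HB.pack_for {mfun T >-> measurableTypeR R} f
   (isMeasurableFun.Build _ _ T (measurableTypeR R) f mf).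
pose q : {mfun_ m, T >-> measurableTypeR R} :=
  (\pi_({mfun_ m, T >-> measurableTypeR R}) F)%qT.
have qF : (q : T -> R) = f %[ae m].
  have /eqmodP/asboolP :
    (repr q = F %[mod {mfun_ m, T >-> measurableTypeR R}])%qT by rewrite reprK.
  by [].
have mq : measurable_fun setT (q : T -> R).
  exact: (measurable_funPT (repr q)).
have fq : finite_norm m p%:E (q : T -> R).
  by rewrite /finite_norm (@Lnorm_ae_eq _ _ _ _ _ _ f).
pose u : LspaceType m p1 := HB.pack_for (LspaceType m p1) q
  (isFinLebesgue.Build _ _ _ m p%:E p1 q fq).
by exists u.
Qed.

(** If the integrals agreed, the nonnegative function g - f would vanish almost
    everywhere, in particular at some point of E. *)
Lemma lt_Rintegral d (T : measurableType d) (R : realType)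
    (m : {measure set T -> \bar R}) (D E : set T) (f g : T -> R) :
  measurable D -> measurable E -> E `<=` D -> (0 < m E)%E ->
  m.-integrable D (EFin \o f) -> m.-integrable D (EFin \o g) ->
  (forall x, D x -> f x <= g x) -> (forall x, E x -> f x < g x) ->
  (\int[m]_(x in D) f x < \int[m]_(x in D) g x).
Proof.
move=> mD mE ED mE0 fi gi fg fgE.
rewrite -subr_gt0 -RintegralB// lt_neqAle Rintegral_ge0 ?andbT; last first.
  by move=> x Dx; rewrite subr_ge0 fg.
apply/eqP => int0.
have gfi : m.-integrable D (EFin \o (fun x => g x - f x)).
  rewrite (_ : _ \o _ = (EFin \o g) \- (EFin \o f))%E; last exact/funext.
  exact: integrableB.
have : ae_eq m D (EFin \o (fun x => g x - f x)) (cst 0%E).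
  apply/ae_eq_integral_abs => //; first exact: measurable_int gfi.
  rewrite (eq_integral (EFin \o (fun x => g x - f x))); last first.
    move=> x /set_mem Dx; rewrite gee0_abs//= lee_fin subr_ge0.
    exact: fg.
  rewrite -(fineK (integrable_fin_num mD gfi)).
  by rewrite -[X in X%:E]/(Rintegral _ _ _) -int0.
move=> [N [mN N0 DN]].
suff : (m E <= m N)%E by rewrite N0 leNgt mE0.
apply: le_measure; rewrite ?inE// => x Ex.
apply: DN => /= /(_ (ED _ Ex)) [] /eqP.
by rewrite subr_eq0 gt_eqF// fgE.
Qed.

(** * Needle perturbations in L^4 of an interval *)

Section open_interval.
Context (R : realType).
Variables a b : R.

Lemma ae_eq_lebesgue_on (T : Type) (f g : R -> T) :
  f = g %[ae lebesgue_on a b] ->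
  ae_eq (@lebesgue_measure R) `]a, b[%classic f g.
Proof.
move=> [N [mN N0 fgN]].
exists (N `&` `]a, b[); split => //; first exact: measurableI.
move=> x /= /not_implyP[xab fgx]; split => //.
by apply: fgN => /= /(_ Logic.I).
Qed.

Lemma ae_in_lebesgue_on : \forall x \ae lebesgue_on a b, x \in `]a, b[.
Proof.
exists (~` `]a, b[); split => //; first exact: measurableC.
by rewrite /= /mrestr setICl measure0.
Qed.

Lemma within_continuous_bounded (f : R -> R) :
  a <= b -> {within `[a, b], continuous f} ->
  exists2 K : R, 0 < K & forall x, x \in `[a, b] -> `|f x| <= K.
Proof.
move=> ab cf.
have [M _ fM] := EVT_max ab cf; have [m _ fm] := EVT_min ab cf.
exists (`|f M| + `|f m| + 1); first by rewrite ltr_pwDr// addr_ge0.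
move=> x xab; rewrite ler_norml; apply/andP; split.
- apply: le_trans (fm _ xab).
  by have := ler_norm (- f m); rewrite normrN; have := normr_ge0 (f M); lra.
- apply: le_trans (fM _ xab) _.
  by have := ler_norm (f M); have := normr_ge0 (f m); lra.
Qed.

Lemma within_continuous_measurable (f : R -> R) :
  {within `[a, b], continuous f} -> measurable_fun `[a, b] f.
Proof. by move=> cf; apply: subspace_continuous_measurable_fun. Qed.

Lemma within_continuous_integrable (f : R -> R) :
  {within `[a, b], continuous f} ->
  (@lebesgue_measure R).-integrable `]a, b[ (EFin \o f).
Proof.
move=> cf.
have cfi := continuous_compact_integrable (@segment_compact _ a b) cf.
apply: integrableS cfi => //; exact: subset_itv_oo_cc.
Qed.

(** The competitor w replaces u to the left of c only, so on ]a, b[ the two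
    profiles differ at most on ]a, c[. *)
Definition needle (c : R) (u w : R -> R) (x : R) : R :=
  if x < c then w x else u x.

Lemma measurable_needle (c : R) (u w : R -> R) (D : set R) : measurable D ->
  measurable_fun D u -> measurable_fun D w -> measurable_fun D (needle c u w).
Proof.
move=> mD mu mw; apply: measurable_fun_if => //.
- by apply: measurable_fun_ltr.
- by apply: measurable_funS mw => //; apply: subIsetl.
- by apply: measurable_funS mu => //; apply: subIsetl.
Qed.

Lemma L4_of_needle (c : R) (u w : R -> R) : a <= b ->
  {within `[a, b], continuous u} -> {within `[a, b], continuous w} ->
  exists U : L4 a b, (U : R -> R) = needle c u w %[ae lebesgue_on a b].
Proof.
move=> ab cu cw.
have [Ku Ku0 uK] := within_continuous_bounded _ ab cu.
have [Kw Kw0 wK] := within_continuous_bounded _ ab cw.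
pose f := needle c u w \_ `[a, b].
have mf : measurable_fun setT f.
  apply/(measurable_restrictT _ (measurable_itv `[a, b])).
  by apply: measurable_needle => //; exact: within_continuous_measurable.
have fK x : `|f x| <= (Ku + Kw) * \1_(setT : set R) x.
  rewrite indicT mulr1 /f patchE; case: ifPn => [/set_mem xab|_]; last first.
    by rewrite normr0 addr_ge0// ltW.
  rewrite /needle; case: ifPn => _.
    by rewrite (le_trans (wK _ _))// lerDr ltW.
  by rewrite (le_trans (uK _ _))// lerDl ltW.
have [|U Uf] := @Lspace_of_fun _ _ _ (lebesgue_on a b) 4 (@le1_4e R) f mf.
  have KuKw : 0 <= Ku + Kw by rewrite addr_ge0// ltW.
  have /= fN := @Lnorm_le_indic _ _ _ (lebesgue_on a b) 4 _ f setT
    (ltr0Sn R 3) KuKw measurableT mf fK.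
  apply: (@lty_poweRy _ _ 4); first by rewrite pnatr_eq0.
  apply: le_lt_trans fN _; rewrite /mrestr setTI lebesgue_measure_itv/=.
  by case: ifPn => _; rewrite ?mule0// -EFinB -EFinM ltry.
exists U; apply: (filterS2 _ _ Uf ae_in_lebesgue_on) => x + xab _.
move=> /(_ Logic.I) ->; rewrite /f patchE mem_set//.
exact: subset_itv_oo_cc.
Qed.

(** With K a bound of |w - u| on [a, b], the fourth power of the distance is at
    most K^4 (c - a). *)
Lemma needle_close (u w : R -> R) (U : L4 a b) (e : R) : a < b -> 0 < e ->
  {within `[a, b], continuous u} -> {within `[a, b], continuous w} ->
  (U : R -> R) = u %[ae lebesgue_on a b] ->
  exists2 c, c \in `]a, b] &
    forall W : L4 a b, (W : R -> R) = needle c u w %[ae lebesgue_on a b] ->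
      (Lspace_dist W U < e%:E)%E.
Proof.
move=> ab e0 cu cw Uu.
have cwu : {within `[a, b], continuous (w \- u)} by exact: within_continuousB.
have [K K0 wuK] := within_continuous_bounded _ (ltW ab) cwu.
(* delta <= b - a keeps c in ]a, b]; the other bound gives
   K^4 delta <= e^4 / 2. *)
pose delta := Num.min (b - a) (e ^+ 4 / (K ^+ 4 * 2)).
have delta0 : 0 < delta.
  by rewrite lt_min subr_gt0 ab/= divr_gt0 ?mulr_gt0 ?exprn_gt0.
have deltab : delta <= b - a by rewrite ge_min lexx.
have Kdelta : K ^+ 4 * delta < e ^+ 4.
  have : K ^+ 4 * delta <= e ^+ 4 / 2.
    rewrite -ler_pdivlMl ?exprn_gt0// ge_min; apply/orP; right.
    by rewrite invfM mulrCA mulrA.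
  have : 0 < e ^+ 4 by rewrite exprn_gt0.
  lra.
exists (a + delta); first by rewrite in_itv/=; lra.
move=> W Wn.
pose g := (w \- u) \_ `]a, (a + delta)[.
have gsub : `]a, (a + delta)[ `<=` `[a, b].
  by move=> x/=; rewrite !in_itv/=; lra.
have mg : measurable_fun setT g.
  apply/(measurable_restrictT _ (measurable_itv `]a, (a + delta)[)).
  apply: (@measurable_funS _ _ _ _ `[a, b]) => //.
  exact: within_continuous_measurable.
have mWU : measurable_fun setT (fun x => (W x : R) - (U x : R)).
  apply: measurable_funB.
    exact: (measurable_funPT (repr (W : {mfun_ _, _ >-> _}))).
  exact: (measurable_funPT (repr (U : {mfun_ _, _ >-> _}))).
have WUg : (fun x => (W x : R) - (U x : R)) = g %[ae lebesgue_on a b].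
  apply: (@filterS3 _ _ (ae_filter_ringOfSetsType _) _ _ _ _ _
    Wn Uu ae_in_lebesgue_on) => x + + xab _.
  move=> /(_ Logic.I) -> /(_ Logic.I) ->.
  rewrite /needle /g patchE; case: ifPn => xc.
    by rewrite mem_set//=; move: xab; rewrite /= !in_itv/= xc => /andP[->].
  rewrite subrr memNset//=; rewrite in_itv/= => /andP[_ xc'].
  by rewrite xc' in xc.
have -> : Lspace_dist W U = 'N[lebesgue_on a b]_4%:E[EFin \o g]%E.
  exact: (@Lnorm_ae_eq _ _ _ (lebesgue_on a b) 4 _ _ mWU mg WUg).
rewrite ltNge; apply/negP => eN.
have : (e%:E `^ 4 <= 'N[lebesgue_on a b]_4%:E[EFin \o g] `^ 4)%E.
  apply: gt0_ler_poweR => //.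
    by rewrite in_itv/= lee_fin ltW//= leey.
  by rewrite in_itv/= Lnorm_ge0 leey.
apply/negP; rewrite -ltNge.
have gK x : `|g x| <= K * \1_(`]a, (a + delta)[%classic) x.
  rewrite /g patchE indicE; case: ifPn => [/set_mem xa|_].
    by rewrite mulr1; apply: wuK; exact: gsub.
  by rewrite normr0 mulr0.
have mE : measurable (`]a, (a + delta)[ : set R) by [].
have gN := @Lnorm_le_indic _ _ _ (lebesgue_on a b) 4 _ g _
  (ltr0Sn R 3) (ltW K0) mE mg gK.
apply: le_lt_trans gN _.
rewrite /= /mrestr setIidl; last by move=> x/=; rewrite !in_itv/=; lra.
rewrite lebesgue_measure_itv/= lte_fin ltrDl delta0 -EFinB -EFinM lte_fin.
by rewrite !powR_mulrn ?ltW// (addrC a) addrK.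
Qed.

End open_interval.

Arguments needle {R} c u w x.

(** * Continuity on an interval *)

Lemma within_continuousV (R : realType) (A : set R) (f : R -> R) :
  {within A, continuous f} -> (forall x, A x -> f x != 0) ->
  {within A, continuous (fun x => (f x)^-1)}.
Proof.
move=> /subspace_continuousP cf f0; apply/subspace_continuousP => x Ax.
by apply: cvgV; [exact: f0|exact: cf].
Qed.

Lemma within_continuousM (R : realType) (A : set R) (f g : R -> R) :
  {within A, continuous f} -> {within A, continuous g} ->
  {within A, continuous (fun x => f x * g x)}.
Proof.
move=> /subspace_continuousP cf /subspace_continuousP cg.
by apply/subspace_continuousP => x Ax; apply: cvgM; [exact: cf|exact: cg].
Qed.

Lemma within_continuous_cst (R : realType) (A : set R) (k : R) :
  {within A, continuous (fun=> k)}.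
Proof. by apply: continuous_subspaceT => x; exact: cvg_cst. Qed.

Lemma within_continuous_id (R : realType) (A : set R) :
  {within A, continuous (fun x : R => x)}.
Proof. by apply: continuous_subspaceT => x; exact: cvg_id. Qed.

(** * The energy under a needle perturbation *)

Section energy.
Context (R : realType).
Variables (alpha mu nu tau a b : R).
Hypotheses (a_gt0 : 0 < a) (a_lt_b : a < b).

Definition density (r y : R) : R :=
  (1 / 2 * mu * r ^+ 2 * y ^+ 2
   + 1 / 2 * nu * (1 / 2 * r ^+ 2 * y ^+ 2 - alpha * r * y) ^+ 2
   - sigma tau b r * r * y) * r.

Lemma radius_neq0 r : r \in `[a, b] -> r != 0.
Proof.
by rewrite in_itv/= => /andP[ar _]; rewrite gt_eqF// (lt_le_trans a_gt0).
Qed.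

Lemma within_continuous_sigma : {within `[a, b], continuous (sigma tau b)}.
Proof.
apply: within_continuousM; first exact: within_continuous_cst.
apply: within_continuousV; last by move=> r /radius_neq0; exact: expf_neq0.
apply: within_continuousM; exact: within_continuous_id.
Qed.

Lemma within_continuous_density (v : R -> R) : {within `[a, b], continuous v} ->
  {within `[a, b], continuous (fun r => density r (v r))}.
Proof.
move=> cv.
have cid : {within `[a, b], continuous (fun r : R => r)}.
  exact: within_continuous_id.
have ccst k : {within `[a, b], continuous (fun=> k : R)}.
  exact: within_continuous_cst.
have csqr (f : R -> R) : {within `[a, b], continuous f} ->
    {within `[a, b], continuous (fun r => f r ^+ 2)}.
  by move=> cf; exact: within_continuousM.
rewrite /density; apply: within_continuousM => //; apply: within_continuousB.
  apply: within_continuousD.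
    by do 2 (apply: within_continuousM; last exact: csqr).
  apply: within_continuousM => //; apply: (csqr); apply: within_continuousB.
    by do 2 (apply: within_continuousM; last exact: csqr).
  by apply: within_continuousM => //; exact: within_continuousM.
apply: within_continuousM => //; apply: within_continuousM => //.
exact: within_continuous_sigma.
Qed.

Lemma measurable_density (v : R -> R) : measurable_fun `]a, b[ v ->
  measurable_fun `]a, b[ (fun r => density r (v r)).
Proof.
move=> mv.
have msigma : measurable_fun `]a, b[ (sigma tau b).
  apply: (@measurable_funS _ _ _ _ `[a, b]) => //.
    exact: subset_itv_oo_cc.
  exact: within_continuous_measurable within_continuous_sigma.
rewrite /density; apply: measurable_funM => //; apply: measurable_funB.
  apply: measurable_funD.
    by apply: measurable_funM; [apply: measurable_funM|exact: measurable_funX].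
  apply: measurable_funM => //; apply: measurable_funX.
  apply: measurable_funB.
    by apply: measurable_funM; [apply: measurable_funM|exact: measurable_funX].
  by apply: measurable_funM => //; exact: measurable_funM.
by apply: measurable_funM => //; exact: measurable_funM.
Qed.

Lemma needle_integrable (c : R) (f g : R -> R) :
  {within `[a, b], continuous f} -> {within `[a, b], continuous g} ->
  (@lebesgue_measure R).-integrable `]a, b[ (EFin \o needle c f g).
Proof.
move=> cf cg.
have mab (h : R -> R) :
    {within `[a, b], continuous h} -> measurable_fun `]a, b[ h.
  move=> ch; apply: (@measurable_funS _ _ _ _ `[a, b]) => //.
    exact: subset_itv_oo_cc.
  exact: within_continuous_measurable.
have fgi : (@lebesgue_measure R).-integrable `]a, b[
    ((abse \o (EFin \o f)) \+ (abse \o (EFin \o g)))%E.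
  by apply: integrableD => //; apply: integrable_abse;
    exact: within_continuous_integrable.
apply: le_integrable fgi => //.
  by apply/measurable_EFinP; apply: measurable_needle => //; exact: mab.
move=> x _ /=; rewrite lee_fin [leRHS]ger0_norm ?addr_ge0//.
by rewrite /needle; case: ifPn => _; rewrite ?lerDl ?lerDr.
Qed.

(** Evaluating the density commutes with the choice between u and w, and the
    integral does not see the null set where V differs from the needle. *)
Lemma Phat_needle (c : R) (u w : R -> R) (V : L4 a b) :
  {within `[a, b], continuous u} -> {within `[a, b], continuous w} ->
  (V : R -> R) = needle c u w %[ae lebesgue_on a b] ->
  Phat alpha mu nu tau V = 2 * pi * \int[lebesgue_measure]_(r in `]a, b[)
    needle c (fun r => density r (u r)) (fun r => density r (w r)) r.
Proof.
move=> cu cw Vn; congr (_ * fine _).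
apply: ae_eq_integral => //.
- apply/measurable_EFinP; apply: measurable_density.
  apply: measurable_funTS.
  exact: (measurable_funPT (repr (V : {mfun_ _, _ >-> _}))).
- apply: (@measurable_int _ _ _ lebesgue_measure).
  by apply: needle_integrable; exact: within_continuous_density.
- apply: ae_eq_lebesgue_on.
  apply: (@filterS _ _ (ae_filter_ringOfSetsType _) _ _ _ Vn).
  move=> r /(_ Logic.I) Vr _.
  by rewrite /= Vr /needle /density; case: ifP.
Qed.

Lemma needle_id (c : R) (u : R -> R) : needle c u u = u.
Proof. by apply/funext => x; rewrite /needle; case: ifP. Qed.

Lemma lt_Rintegral_needle (c : R) (f g h : R -> R) : c \in `]a, b] ->
  {within `[a, b], continuous f} -> {within `[a, b], continuous g} ->
  {within `[a, b], continuous h} ->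
  (forall r, r \in `[a, b] -> f r < g r) ->
  \int[lebesgue_measure]_(r in `]a, b[) needle c h f r <
  \int[lebesgue_measure]_(r in `]a, b[) needle c h g r.
Proof.
rewrite in_itv/= => /andP[ac cb] cf cg ch fg.
apply: (@lt_Rintegral _ _ _ lebesgue_measure _ `]a, c[) => //.
- by move=> x/=; rewrite !in_itv/=; lra.
- by rewrite /= lebesgue_measure_itv/= lte_fin ac -EFinB lte_fin subr_gt0.
- exact: needle_integrable.
- exact: needle_integrable.
- move=> x xab; rewrite /needle; case: ifP => // _; apply/ltW/fg.
  exact: subset_itv_oo_cc xab.
- move=> x/=; rewrite in_itv/= /needle => /andP[ax xc]; rewrite xc.
  by apply: fg; rewrite in_itv/=; lra.
Qed.

Lemma not_local_min_of_lower (u w : R -> R) (U : L4 a b) :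
  {within `[a, b], continuous u} -> {within `[a, b], continuous w} ->
  (U : R -> R) = u %[ae lebesgue_on a b] ->
  (forall r, r \in `[a, b] -> density r (w r) < density r (u r)) ->
  ~ is_local_min (@Phat R alpha mu nu tau a b) U.
Proof.
move=> cu cw Uu wu [e e0 minU].
have [c cab close] := needle_close _ _ _ _ _ _ _ a_lt_b e0 cu cw Uu.
have [W Wn] := L4_of_needle _ _ _ c _ _ (ltW a_lt_b) cu cw.
have := minU _ (close _ Wn); apply/negP; rewrite -ltNge.
(* Reading u as the needle with equal profiles turns both energies into
   integrals of needles at the same c. *)
rewrite -(needle_id c u) in Uu.
rewrite (Phat_needle _ _ _ _ cu cw Wn) (Phat_needle _ _ _ _ cu cu Uu).
rewrite ltr_pM2l ?mulr_gt0 ?pi_gt0//.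
by apply: lt_Rintegral_needle => //; exact: within_continuous_density.
Qed.

Lemma not_local_max_of_higher (u w : R -> R) (U : L4 a b) :
  {within `[a, b], continuous u} -> {within `[a, b], continuous w} ->
  (U : R -> R) = u %[ae lebesgue_on a b] ->
  (forall r, r \in `[a, b] -> density r (u r) < density r (w r)) ->
  ~ is_local_max (@Phat R alpha mu nu tau a b) U.
Proof.
move=> cu cw Uu wu [e e0 maxU].
have [c cab close] := needle_close _ _ _ _ _ _ _ a_lt_b e0 cu cw Uu.
have [W Wn] := L4_of_needle _ _ _ c _ _ (ltW a_lt_b) cu cw.
have := maxU _ (close _ Wn); apply/negP; rewrite -ltNge.
(* Reading u as the needle with equal profiles turns both energies into
   integrals of needles at the same c. *)
rewrite -(needle_id c u) in Uu.
rewrite (Phat_needle _ _ _ _ cu cw Wn) (Phat_needle _ _ _ _ cu cu Uu).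
rewrite ltr_pM2l ?mulr_gt0 ?pi_gt0//.
by apply: lt_Rintegral_needle => //; exact: within_continuous_density.
Qed.

(** * Two competitors in the double well *)

Definition well (r t : R) : R :=
  nu / 8 * (t ^+ 2 - alpha ^+ 2) ^+ 2 + mu / 2 * t ^+ 2
  + beta alpha mu tau b r * t.

Lemma densityE r t : r != 0 -> density r (r^-1 * (alpha + t)) =
  r * (well r t + (mu / 2 * alpha ^+ 2 - sigma tau b r * alpha)).
Proof.
move=> r0; rewrite /density /well /beta; move: (sigma _ _ _) => s.
by field.
Qed.

(** Adding a function of r alone and multiplying by r > 0 preserve the
    comparison. *)
Lemma lt_density r s t : r \in `[a, b] ->
  (density r (r^-1 * (alpha + s)) < density r (r^-1 * (alpha + t))) =
  (well r s < well r t).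
Proof.
move=> rab; rewrite !densityE ?radius_neq0// ltr_pM2l ?ltrD2r//.
by move: rab; rewrite in_itv/=; move: a_gt0; lra.
Qed.

(** The well is even except for its linear term. *)
Lemma well_reflect r t :
  0 < beta alpha mu tau b r * t -> well r (- t) < well r t.
Proof. by rewrite /well !sqrrN mulrN; lra. Qed.

(** The three terms grow separately. Since (t + 2 q)^2 = t^2 + 4 alpha^2 + 4 q^2
    for q = alpha^2 / t, the new t^2 - alpha^2 exceeds t^2 + alpha^2, which
    dominates the absolute value of the old one; and q has the sign of t, so
    the linear term increases as well. *)
Lemma well_stretch r t : 0 < alpha -> 0 < mu -> 0 < nu ->
  0 < beta alpha mu tau b r * t ->
  well r t < well r (t + 2 * alpha ^+ 2 / t).
Proof.
rewrite /well; move: (beta _ _ _ _ _) => s al0 mu0 nu0 st.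
have t0 : t != 0 by apply: contraTneq st => ->; rewrite mulr0 ltxx.
set q := alpha ^+ 2 / t.
have -> : 2 * alpha ^+ 2 / t = 2 * q by rewrite /q mulrA.
have tq : t * q = alpha ^+ 2 by rewrite /q mulrCA mulfV// mulr1.
have al2 : 0 < alpha ^+ 2 by rewrite exprn_gt0.
have sq : 0 < s * q.
  have -> : s * q = s * t * (alpha ^+ 2 / t ^+ 2) by rewrite /q; field.
  by rewrite mulr_gt0// divr_gt0// exprn_even_gt0.
have t2 : 0 < t ^+ 2 by rewrite exprn_even_gt0.
have q2 : 0 <= q ^+ 2 by rewrite sqr_ge0.
have tqE : (t + 2 * q) ^+ 2 = t ^+ 2 + 4 * alpha ^+ 2 + 4 * q ^+ 2.
  by rewrite -tq; ring.
rewrite tqE.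
have quartic : (t ^+ 2 - alpha ^+ 2) ^+ 2 <=
    (t ^+ 2 + 4 * alpha ^+ 2 + 4 * q ^+ 2 - alpha ^+ 2) ^+ 2.
  rewrite -ler_sqrt ?sqr_ge0// !sqrtr_sqr [leRHS]ger0_norm; last lra.
  by rewrite ler_norml; apply/andP; split; lra.
have nuq : nu / 8 * (t ^+ 2 - alpha ^+ 2) ^+ 2 <= nu / 8 *
    (t ^+ 2 + 4 * alpha ^+ 2 + 4 * q ^+ 2 - alpha ^+ 2) ^+ 2.
  by rewrite ler_wpM2l// divr_ge0// ltW.
have muq : mu / 2 * t ^+ 2 < mu / 2 * (t ^+ 2 + 4 * alpha ^+ 2 + 4 * q ^+ 2).
  by rewrite ltr_pM2l ?divr_gt0//; lra.
rewrite mulrDr mulrCA; lra.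
Qed.

(** * The profiles attached to roots below - mu *)

Variable zeta : R -> R.
Hypothesis zeta_cont : {within `[a, b], continuous zeta}.
Hypothesis zeta_lt : forall r, r \in `[a, b] -> zeta r < - mu.
Hypothesis beta_neq0 : forall r, r \in `[a, b] -> beta alpha mu tau b r != 0.

Definition shift (r : R) : R := - (beta alpha mu tau b r / (zeta r + mu)).

(** The product equals - beta^2 / (zeta + mu), and zeta + mu < 0. *)
Lemma beta_shift_gt0 r : r \in `[a, b] -> 0 < beta alpha mu tau b r * shift r.
Proof.
move=> rab; rewrite /shift -mulNr mulrA mulrN -expr2 mulNr oppr_gt0.
rewrite pmulr_rlt0 ?invr_lt0 ?exprn_even_gt0 ?beta_neq0//.
by have := zeta_lt _ rab; lra.
Qed.

Lemma within_continuous_shift : {within `[a, b], continuous shift}.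
Proof.
have -> : shift = fun r => beta alpha mu tau b r * - (zeta r + mu)^-1.
  by apply/funext => r; rewrite mulrN.
apply: within_continuousM.
  apply: within_continuousB; first exact: within_continuous_cst.
  exact: within_continuous_sigma.
have -> : (fun r => - (zeta r + mu)^-1) = (fun r => (- (zeta r + mu))^-1).
  by apply/funext => r; rewrite invrN.
apply: within_continuousV; last first.
  by move=> r /zeta_lt zr; rewrite oppr_eq0 lt_eqF//; lra.
have -> : (fun r => - (zeta r + mu)) = (fun r => - mu - zeta r).
  by apply/funext => r; rewrite opprD addrC.
by apply: within_continuousB => //; exact: within_continuous_cst.
Qed.

Lemma within_continuous_profile (t : R -> R) : {within `[a, b], continuous t} ->
  {within `[a, b], continuous (fun r => r^-1 * (alpha + t r))}.
Proof.
move=> ct; apply: within_continuousM.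
  apply: within_continuousV; last by move=> r /radius_neq0.
  exact: within_continuous_id.
by apply: within_continuousD => //; exact: within_continuous_cst.
Qed.

Lemma vbar_not_local_min : exists2 v : L4 a b,
  (v : R -> R) = vbar alpha mu tau b zeta %[ae lebesgue_on a b] &
  ~ is_local_min (@Phat R alpha mu nu tau a b) v.
Proof.
have cs := within_continuous_shift; have cv := within_continuous_profile _ cs.
(* The needle whose two profiles coincide is the profile itself. *)
have [v] := L4_of_needle _ _ _ b _ _ (ltW a_lt_b) cv cv.
rewrite needle_id => vE; exists v => //.
have cNs : {within `[a, b], continuous (fun r => - shift r)}.
  have -> : (fun r => - shift r) = (fun r => -1 * shift r).
    by apply/funext => r; rewrite mulN1r.
  by apply: within_continuousM => //; exact: within_continuous_cst.
apply: (not_local_min_of_lower _ _ _ cv (within_continuous_profile _ cNs) vE).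
by move=> r rab; rewrite lt_density// well_reflect// beta_shift_gt0.
Qed.

Lemma vbar_not_local_max : 0 < alpha -> 0 < mu -> 0 < nu ->
  exists2 v : L4 a b,
  (v : R -> R) = vbar alpha mu tau b zeta %[ae lebesgue_on a b] &
  ~ is_local_max (@Phat R alpha mu nu tau a b) v.
Proof.
move=> al0 mu0 nu0.
have cs := within_continuous_shift; have cv := within_continuous_profile _ cs.
(* The needle whose two profiles coincide is the profile itself. *)
have [v] := L4_of_needle _ _ _ b _ _ (ltW a_lt_b) cv cv.
rewrite needle_id => vE; exists v => //.
have cw : {within `[a, b],
    continuous (fun r => shift r + 2 * alpha ^+ 2 / shift r)}.
  apply: within_continuousD => //; apply: within_continuousM.
    exact: within_continuous_cst.
  apply: within_continuousV => // r rab.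
  have := beta_shift_gt0 _ rab.
  by apply: contraTneq => ->; rewrite mulr0 ltxx.
apply: (not_local_max_of_higher _ _ _ cv (within_continuous_profile _ cw) vE).
by move=> r rab; rewrite lt_density// well_stretch// beta_shift_gt0.
Qed.

End energy.

Theorem mainTheorem2 (R : realType) (alpha mu nu tau a b : R)
  (alpha_gt0 : 0 < alpha) (mu_gt0 : 0 < mu) (nu_gt0 : 0 < nu)
  (tau_gt0 : 0 < tau) (a_gt0 : 0 < a) (a_lt_b : a < b)
  (mu_small : 2 * mu < nu * alpha ^+ 2)
  (beta_bound : forall r : R, r \in `[a, b] ->
    0 < (beta alpha mu tau b r) ^+ 2 < eta_ alpha mu nu)
  (zeta2 zeta3 : R -> R)
  (zeta2_cont : {within `[a, b], continuous zeta2})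
  (zeta3_cont : {within `[a, b], continuous zeta3})
  (zeta2_sol : forall r : R, r \in `[a, b] ->
    cubic alpha mu nu (zeta2 r) = (beta alpha mu tau b r) ^+ 2)
  (zeta3_sol : forall r : R, r \in `[a, b] ->
    cubic alpha mu nu (zeta3 r) = (beta alpha mu tau b r) ^+ 2)
  (zeta2_range : forall r : R, r \in `[a, b] ->
    rho alpha mu nu < zeta2 r < - mu)
  (zeta3_range : forall r : R, r \in `[a, b] ->
    - (1 / 2) * nu * alpha ^+ 2 < zeta3 r < rho alpha mu nu) :
  (exists2 v2 : L4 a b,
     (v2 : R -> R) = vbar alpha mu tau b zeta2 %[ae lebesgue_on a b] &
     ~ is_local_min (@Phat R alpha mu nu tau a b) v2) /\
  (exists2 v3 : L4 a b,
     (v3 : R -> R) = vbar alpha mu tau b zeta3 %[ae lebesgue_on a b] &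
     ~ is_local_max (@Phat R alpha mu nu tau a b) v3).
Proof.
have rho_lt : rho alpha mu nu < - mu by rewrite /rho; lra.
have beta_neq0 r : r \in `[a, b] -> beta alpha mu tau b r != 0.
  move=> /beta_bound /andP[+ _].
  by apply: contraTneq => ->; rewrite expr0n ltxx.
split.
- apply: vbar_not_local_min => // r /zeta2_range /andP[_ //].
- apply: vbar_not_local_max => // r /zeta3_range /andP[_ zr].
  exact: lt_trans zr rho_lt.
Qed.
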